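(* Let $n\ge3$ and $\sigma\in S_{2n}$ with $\mathrm{par}(\sigma)=(a,b)$. Then $$|\mathrm{class}(\sigma)|=\begin{cases}2\cdot n!\cdot n! & \text{if } a=b=n,\\ 2\cdot(n-1)!\cdot(n-1)! & \text{if } a=b=n-1,\\ \max\{a,2\}!\cdot\max\{b,2\}! & \text{otherwise.}\end{cases}$$
   Context: A Dyck path of size $n$ is a word in $\mathtt{u},\mathtt{d}$ with $n$ of each letter whose every prefix has at least as many $\mathtt{u}$'s as $\mathtt{d}$'s; $\mathcal{D}_n$ is their set. The tunneling $\tau_D\in S_{2n}$ of $D$ is the fixed-point-free involution pairing each up-step position with the position of its matching down-step. For $\sigma\in S_{2n}$, $\sigma_k=\sigma(k)$, $\sigma_{[k]}=\{\sigma_1,\dots,\sigma_k\}$; the $\sigma$-path $\sigma(D)$ has $\sigma(D)_k=\mathtt{u}$ if $\tau_D(\sigma_k)\notin\sigma_{[k]}$ and $\mathtt{d}$ otherwise. $\lambda\sim\mu$ iff $\lambda(D)=\mu(D)$ for all $D\in\mathcal{D}_n$; $\mathrm{class}(\sigma)$ is the class of $\sigma$. The parity $\mathrm{par}(\sigma)=(a,b)$: $a$ is the smallest positive integer with $\sigma_a\not\equiv\sigma_{a+1}\pmod2$, $b$ is the smallest positive integer with $\sigma_{2n+1-b}\not\equiv\sigma_{2n-b}\pmod2$. *)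

(* Defs.v *)
From mathcomp Require Import all_boot all_fingroup.
From mathcomp Require Import zify.

Set Implicit Arguments.
Unset Strict Implicit.
Unset Printing Implicit Defensive.

(* Conventions: the letter u is [true] and the letter d is [false].  The
   positions 1, ..., 2n and the elements permuted by S_2n are represented by
   the ordinals 0, ..., 2n - 1. *)

Definition dyck_word (n : nat) (w : seq bool) : bool :=
  [&& count_mem true w == n, count_mem false w == n &
      all (fun k => count_mem false (take k w) <= count_mem true (take k w))
          (iota 0 (size w).+1)].

Definition Dyck (n : nat) : {set (2 * n).-tuple bool} :=
  [set D : (2 * n).-tuple bool | dyck_word n D].

(* The factor of [w] strictly between the positions [i] and [j]. *)
Definition factor (w : seq bool) (i j : nat) : seq bool :=
  drop i.+1 (take j w).

Definition matched (w : seq bool) (i j : nat) : bool :=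
  [&& i < j, nth false w i, ~~ nth true w j &
      dyck_word (count_mem true (factor w i j)) (factor w i j)].

(* [tunnel D] fixes the unmatched positions; a Dyck path has none, see
   [tunneling_fixfree] below. *)
Definition tunnel (N : nat) (D : N.-tuple bool) (i : 'I_N) : 'I_N :=
  odflt i [pick j : 'I_N | matched D i j || matched D j i].

Section TunnelFacts.

Implicit Types (w : seq bool) (i j k : nat).

Let up w k := count_mem true (take k w).
Let dn w k := count_mem false (take k w).

Let upD w k : k <= size w -> up w k + dn w k = k.
Proof.
move=> lek; rewrite -[RHS](size_takel lek) -(count_predC (pred1 true)).
by congr (_ + _); apply: eq_count => -[].
Qed.

Let upS w k : k < size w -> up w k.+1 = up w k + nth false w k.
Proof. by move=> lk; rewrite /up (take_nth false) // -cats1 count_cat /=; case: nth. Qed.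

Let count_factor (b : bool) w i k : i < k ->
  count_mem b (drop i.+1 (take k w)) + count_mem b (take i.+1 w)
  = count_mem b (take k w).
Proof.
move=> ik; rewrite addnC -count_cat -{2}(cat_take_drop i.+1 (take k w)).
by rewrite take_takel.
Qed.

Let matchedP w i j : j < size w ->
  reflect [/\ i < j, nth false w i, ~~ nth false w j, up w j.+1 + up w j.+1 + i = up w i + up w i + j.+1 &
           forall k, i < k <= j -> up w i + up w i + k < up w k + up w k + i]
          (matched w i j).
Proof.
move=> js; rewrite /matched (set_nth_default false) //.
case: (ltnP i j) => [ij|]; last by move=> ?; constructor; case; lia.
case ui: (nth false w i); last by constructor; case.
case uj: (nth false w j); first by constructor; case.
have Eu := count_factor true w ij; have Ed := count_factor false w ij.
have := upS js; have := upS (ltn_trans ij js); rewrite ui uj => S1 S2.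
have U1 := upD (ltnW js); have U2 : up w i.+1 + dn w i.+1 = i.+1 by apply: upD; lia.
rewrite !andTb /dyck_word eqxx andTb; apply: (iffP andP) => [[/eqP e /allP A]|[_ _ _ e A]].
  split=> //; first by rewrite /up /dn /factor in e S1 S2 U1 U2 Eu Ed *; lia.
  move=> k /andP[ik kj].
  have {}A : count_mem false (drop i.+1 (take k w)) <= count_mem true (drop i.+1 (take k w)).
    have := A (k - i.+1); rewrite mem_iota /factor size_drop (size_takel (ltnW js)).
    by rewrite take_drop subnK // take_takel //; apply; lia.
  have Fu := count_factor true w ik; have Fd := count_factor false w ik.
  have U3 : up w k + dn w k = k by apply: upD; lia.
  by rewrite /up /dn in S1 S2 U1 U2 U3 *; lia.
split; first by apply/eqP; rewrite /up /dn /factor in e S1 S2 U1 U2 Eu Ed *; lia.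
apply/allP=> k; rewrite mem_iota => /andP[_].
rewrite /factor size_drop (size_takel (ltnW js)) => kj.
rewrite take_drop take_takel; last lia.
have ik : i < k + i.+1 by lia.
have Fu := count_factor true w ik; have Fd := count_factor false w ik.
have U3 : up w (k + i.+1) + dn w (k + i.+1) = k + i.+1 by apply: upD; lia.
have := A (k + i.+1) ltac:(lia); rewrite /up /dn in S1 S2 U1 U2 U3 *; lia.
Qed.

Let matched_funr w i j k : j < size w -> k < size w ->
  matched w i j -> matched w i k -> j = k.
Proof.
move=> js ks /(matchedP _ js)[ij _ _ e1 A1] /(matchedP _ ks)[ik _ _ e2 A2].
by have [||//] := ltngtP j k => jk; [have := A2 j.+1 | have := A1 k.+1]; lia.
Qed.

Let matched_funl w i j k : k < size w ->
  matched w i k -> matched w j k -> i = j.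
Proof.
move=> ks /(matchedP _ ks)[ik _ _ e1 A1] /(matchedP _ ks)[jk _ _ e2 A2].
by have [||//] := ltngtP i j => ij; [have := A1 j | have := A2 i]; lia.
Qed.

Let matched_irr w i j k : i < size w -> matched w i j -> ~~ matched w k i.
Proof.
move=> si /and4P[_ wi _ _]; apply/negP => /and4P[_ _ /negP].
by rewrite (set_nth_default false).
Qed.

Let tunnelP N (D : N.-tuple bool) (i j : 'I_N) :
  matched D i j || matched D j i -> tunnel D i = j.
Proof.
have sN (k : 'I_N) : k < size D by rewrite size_tuple.
rewrite /tunnel; case: pickP => [k|/(_ j)->//] /= mk mj; apply/val_inj => /=.
case/orP: mk => mk; case/orP: mj => mj.
- exact: matched_funr mk mj.
- by rewrite (negPf (matched_irr _ _ mk)) in mj.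
- by rewrite (negPf (matched_irr _ _ mj)) in mk.
- exact: matched_funl mk mj.
Qed.

Lemma tunnelK N (D : N.-tuple bool) : involutive (tunnel D).
Proof.
move=> i; rewrite {2}/tunnel; case: pickP => [j m|m0] /=.
  by apply: tunnelP; rewrite orbC.
by rewrite /tunnel; case: pickP => // j; rewrite m0.
Qed.

Let partner w i : up w (size w) + up w (size w) = size w ->
    (forall k, k <= size w -> k <= up w k + up w k) -> i < size w ->
  exists2 j, j < size w & matched w i j || matched w j i.
Proof.
move=> e0 P si; case wi: (nth false w i).
  pose Q j := [&& i < j, j < size w & up w j.+1 + up w j.+1 + i <= up w i + up w i + j.+1].
  have exQ : exists j, Q j.
    exists (size w).-1; have U := upS si; rewrite wi in U.
    have : i.+1 < size w.
      by case: (ltngtP i.+1 (size w)) => // E; [lia | rewrite -E in e0; have := P i; lia].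
    by move=> is'; apply/and3P; split; [lia | lia | rewrite prednK; [have := P i; lia | lia]].
  case: (ex_minnP exQ) => j /and3P[ij js e] jmin; exists j => //.
  have A k : i < k <= j -> up w i + up w i + k < up w k + up w k + i.
    case: k => // k /andP[ik kj]; have [ik'|ki] := ltnP i k.
      by rewrite ltnNge; apply/negP => h; have := jmin k; rewrite /Q h ik'; lia.
    by have -> : k = i; [lia | have := upS si; rewrite wi; lia].
  have := A j ltac:(lia); have := upS js; case wj: (nth false w j) => Uj Aj; first lia.
  by apply/orP; left; apply/(matchedP _ js); split; rewrite ?wj //; lia.
pose Q j := (j < i) && (up w j + up w j + i.+1 <= up w i.+1 + up w i.+1 + j).
have Ui := upS si; rewrite wi in Ui.
have exQ : exists j, Q j.
  have u0 : up w 0 = 0 by rewrite /up take0.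
  exists 0; have Pi := P i.+1 si; rewrite /Q u0.
  have i0 : 0 < i by rewrite lt0n; apply/eqP => i0; rewrite i0 in Ui Pi; lia.
  lia.
have bQ j : Q j -> j <= i by case/andP => /ltnW.
case: (ex_maxnP exQ bQ) => j /andP[ji e] jmax; exists j; first lia.
have sj : j < size w by lia.
have A k : j < k <= i -> up w i.+1 + up w i.+1 + k < up w k + up w k + i.+1.
  move=> /andP[jk ki]; have [ik'|ki'] := ltnP k i.
    by rewrite ltnNge; apply/negP => h; have := jmax k; rewrite /Q; lia.
  by have -> : k = i; lia.
have := A j.+1 ltac:(lia); have := upS sj; case wj: (nth false w j) => Uj Aj; last lia.
apply/orP; right; apply/(matchedP _ si); split; rewrite ?wi //; first lia.
by move=> k hk; have := A k hk; lia.
Qed.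

Lemma tunnel_matched n (D : (2 * n).-tuple bool) (i : 'I_(2 * n)) : D \in Dyck n ->
  matched D i (tunnel D i) || matched D (tunnel D i) i.
Proof.
rewrite inE => /and3P[/eqP cu /eqP cd /allP A].
have [||| j sj m] := @partner D i.
- by rewrite /up take_size cu size_tuple; lia.
- move=> k sk; have := A k; rewrite mem_iota => /(_ ltac:(lia)).
  by have := upD sk; rewrite /up /dn; lia.
- by rewrite size_tuple.
rewrite /tunnel; case: pickP => [//|].
by rewrite size_tuple in sj; move/(_ (Ordinal sj)); rewrite /= m.
Qed.

End TunnelFacts.

Definition tunneling (N : nat) (D : N.-tuple bool) : 'S_N :=
  perm (inv_inj (tunnelK D)).

Lemma tunneling_fixfree n (D : (2 * n).-tuple bool) i :
  D \in Dyck n -> tunneling D i != i.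
Proof.
move=> /(tunnel_matched i); rewrite permE /matched; apply: contraTneq => ->.
by rewrite ltnn.
Qed.

(* The set {sigma_1, ..., sigma_k}, where [i] stands for the position k. *)
Definition prefix_set (N : nat) (s : 'S_N) (i : 'I_N) : {set 'I_N} :=
  [set s j | j : 'I_N & j <= i].

Definition sigma_path (N : nat) (s : 'S_N) (D : N.-tuple bool) :
    N.-tuple bool :=
  [tuple tunneling D (s i) \notin prefix_set s i | i < N].

Definition path_equiv (n : nat) (l m : 'S_(2 * n)) : bool :=
  [forall D in Dyck n, sigma_path l D == sigma_path m D].

Definition path_class (n : nat) (s : 'S_(2 * n)) : {set 'S_(2 * n)} :=
  [set l | path_equiv l s].

(* The integer sigma_k in {1, ..., N}, for 1 <= k <= N. *)
Definition entry (N : nat) (s : 'S_N) (k : nat) : nat :=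
  nth 0 [seq (s i).+1 | i : 'I_N] k.-1.

(* The smallest k in {1, ..., N - 1} satisfying P, if there is one. *)
Definition first_index (N : nat) (P : pred nat) : nat :=
  (find P (iota 1 N.-1)).+1.

Definition par (n : nat) (s : 'S_(2 * n)) : nat * nat :=
  (first_index (2 * n)
     (fun a => entry s a != entry s a.+1 %[mod 2]),
   first_index (2 * n)
     (fun b => entry s (2 * n + 1 - b) != entry s (2 * n - b) %[mod 2])).

Section ParFacts.

Lemma entryE N (s : 'S_N) (i : 'I_N) : entry s i.+1 = (s i).+1.
Proof.
by rewrite /entry /= (nth_map i) ?size_enum_ord // nth_ord_enum.
Qed.

Let first_indexP N (P : pred nat) : (exists2 k, 0 < k < N & P k) ->
  let a := first_index N P in
  [/\ 0 < a < N, P a & forall k, 0 < k < N -> P k -> a <= k].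
Proof.
move=> [k0 k0N Pk0] /=; rewrite /first_index.
have H : has P (iota 1 N.-1) by apply/hasP; exists k0; rewrite // mem_iota; lia.
have := H; rewrite has_find size_iota => lt.
split; first lia.
  by have := nth_find 0 H; rewrite nth_iota // add1n.
move=> k kN Pk; rewrite ltnNge; apply/negP => lek.
have := @before_find _ 0 P (iota 1 N.-1) k.-1; rewrite nth_iota; last lia.
by rewrite add1n prednK; [rewrite Pk => E; have := E ltac:(lia) | lia].
Qed.

Lemma parP n (s : 'S_(2 * n)) : 0 < n ->
  [/\ 0 < (par s).1 < 2 * n,
      entry s (par s).1 != entry s (par s).1.+1 %[mod 2] &
      forall k, 0 < k < 2 * n -> entry s k != entry s k.+1 %[mod 2] ->
        (par s).1 <= k] /\
  [/\ 0 < (par s).2 < 2 * n,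
      entry s (2 * n + 1 - (par s).2) != entry s (2 * n - (par s).2) %[mod 2] &
      forall k, 0 < k < 2 * n ->
        entry s (2 * n + 1 - k) != entry s (2 * n - k) %[mod 2] ->
        (par s).2 <= k].
Proof.
move=> n0.
have [k kn Ek] : exists2 k, 0 < k < 2 * n & entry s k != entry s k.+1 %[mod 2].
  have [/existsP[k /andP[k0 Pk]]|/existsPn H] := boolP [exists k : 'I_(2 * n),
      (0 < k) && (entry s k != entry s k.+1 %[mod 2])].
    by exists k; rewrite ?k0 ?ltn_ord.
  have C k : 0 < k <= 2 * n -> entry s k = entry s 1 %[mod 2].
    elim: k => // -[//|k] IH kn; rewrite -IH; last lia.
    have kn' : k.+1 < 2 * n by lia.
    by have := H (Ordinal kn'); rewrite /= negbK => /eqP ->.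
  have C' (i : 'I_(2 * n)) : (s i).+1 = entry s 1 %[mod 2].
    by rewrite -entryE C //; have := ltn_ord i; lia.
  have l0 : 0 < 2 * n by lia.
  have l1 : 1 < 2 * n by lia.
  have := C' ((s^-1)%g (Ordinal l0)); have := C' ((s^-1)%g (Ordinal l1)).
  by rewrite !permKV /= => <-.
split; apply: first_indexP; first by exists k.
exists (2 * n - k); first lia.
have -> : 2 * n + 1 - (2 * n - k) = k.+1 by lia.
by rewrite eq_sym subKn //; lia.
Qed.

End ParFacts.

(* Main.v *)
Require Import Defs.
From mathcomp Require Import all_boot all_fingroup.
From mathcomp Require Import zify.

Set Implicit Arguments.
Unset Strict Implicit.
Unset Printing Implicit Defensive.

(** The number of d's among the first k letters of the sigma-path of D is the
    number of tunnels of D inside the set of the first k entries of sigma, so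
    two permutations are equivalent iff, for each k, their prefix sets of size
    k contain equally many tunnels of every D.

    If p < q < r < t alternate in parity, some two Dyck paths differ only in
    that one has the tunnels pq, rt and the other pt, qr.  Hence two sets A, B
    with equally many tunnels for every D have indicators a, b satisfying
    (a_p - a_r)(a_q - a_t) = (b_p - b_r)(b_q - b_t), and this extends to all
    p, r of one parity and q, t of the other.  If A and its complement both
    contain both parities, this forces B = A or B = ~A, the latter only when
    |A| = n.  The other sets of a given size are all equivalent.

    The prefix of size k of sigma is of the first kind iff a < k < 2n - b.
    Thus equivalent permutations have the same prefixes in this range, except
    that the prefix of size n may be complemented when it is the only one in
    the range; otherwise a neighbouring prefix excludes this.  A prefix of
    size a >= 2 is also determined, as the one-coloured part of the prefix of
    size a + 1.  What remains free is the order of the first max(a,2) and of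
    the last max(b,2) entries, and the reversal of sigma if a = b >= n - 1. *)

(** * Parity of tunnels *)

Lemma dyck_word_size m w : dyck_word m w -> size w = 2 * m.
Proof.
case/and3P=> /eqP u /eqP d _; rewrite -(count_predC (pred1 true)).
by rewrite u -[X in _ + X]/(count _ _) (eq_count (a2 := pred1 false)) ?d; [lia | case].
Qed.

(** The factor strictly between matched positions is a Dyck word, hence has even length. *)
Lemma matched_odd w i j : j <= size w -> matched w i j -> odd j = ~~ odd i.
Proof.
move=> js /and4P[ij _ _ /dyck_word_size].
by rewrite size_drop size_takel //; lia.
Qed.

Lemma tunneling_odd n (D : (2 * n).-tuple bool) (i : 'I_(2 * n)) :
  D \in Dyck n -> odd (tunneling D i) = ~~ odd i.
Proof.
move=> /(tunnel_matched i); rewrite permE; case/orP => /matched_odd -> //.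
- by rewrite size_tuple ltnW.
- by rewrite negbK.
- by rewrite size_tuple ltnW.
Qed.

Lemma tunnelingK N (D : N.-tuple bool) : involutive (tunneling D).
Proof. by move=> i; rewrite !permE tunnelK. Qed.

(** * Dyck paths from noncrossing involutions *)

Section Noncrossing.

Variables (n : nat) (g : 'I_(2 * n) -> 'I_(2 * n)).
Hypotheses (gK : involutive g) (g_fix : forall i, g i != i).
Hypothesis g_nc : forall i j : 'I_(2 * n), i < j -> j < g i -> i < g j < g i.

Let D : (2 * n).-tuple bool := [tuple i < g i | i < 2 * n].

Let range b l k := [set j : 'I_(2 * n) | (l <= j < k) && ((j < g j) == b)].

Let mem_drop_take_enum N l k (x : 'I_N) : k <= N ->
  (x \in drop l (take k (enum 'I_N))) = (l <= x < k).
Proof.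
move=> kN; rewrite -(mem_map val_inj) map_drop map_take val_enum_ord.
by rewrite take_iota drop_iota mem_iota /=; lia.
Qed.

Let count_range b l k : k <= 2 * n ->
  count_mem b (drop l (take k D)) = #|range b l k|.
Proof.
move=> kN; rewrite /= -map_take -map_drop count_map -size_filter.
set s := filter _ _; have /card_uniqP <- : uniq s.
  by rewrite filter_uniq // drop_uniq // take_uniq // enum_uniq.
by apply: eq_card => x; rewrite mem_filter mem_drop_take_enum // [RHS]inE andbC.
Qed.

Let D_nth x0 (i : 'I_(2 * n)) : nth x0 D i = (i < g i).
Proof. by rewrite -tnth_nth tnth_mktuple. Qed.

(** The fixed-point-free involution [g] exchanges the two letters, so it injects one range into the
    other. *)
Let range_le b l k : (forall j, j \in range b l k -> l <= g j < k) ->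
  #|range b l k| <= #|range (~~ b) l k|.
Proof.
move=> H; rewrite -(card_imset _ (inv_inj gK)); apply/subset_leq_card/subsetP.
move=> _ /imsetP[j jr ->]; rewrite inE H // gK.
by move: jr (g_fix j); rewrite inE -val_eqE => /andP[_ /eqP <-] /=; case: ltngtP.
Qed.

Let range_true_factor (i : 'I_(2 * n)) : i < g i ->
  #|range true i.+1 (g i)| <= #|range false i.+1 (g i)|.
Proof.
move=> ig; apply: (range_le (b := true)) => j; rewrite inE => /andP[h _].
by apply: g_nc; lia.
Qed.

(** The partner of a down-step is earlier, so [g] injects the down-steps of a prefix into its
    up-steps. On the whole word both injections exist. *)
Lemma noncrossing_Dyck : D \in Dyck n.
Proof.
have t : size D = 2 * n by rewrite size_tuple.
have le0 b : #|range b 0 (2 * n)| <= #|range (~~ b) 0 (2 * n)|.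
  by apply: range_le => j _; rewrite /= ltn_ord.
have := count_predC (pred1 true) D; rewrite t.
rewrite (eq_count (a1 := predC _) (a2 := pred1 false)); last by case.
have E b : count_mem b D = #|range b 0 (2 * n)|.
  by rewrite -count_range // drop0 take_oversize // t.
move: (le0 true) (le0 false); rewrite inE /dyck_word !E /negb => h1 h2 h3.
apply/and3P; split; [lia | lia |].
apply/allP=> k; rewrite mem_iota t => h.
rewrite -[take k _]drop0 !count_range; try lia.
apply: (range_le (b := false)) => j; rewrite inE => /andP[h' /eqP h''].
by move/negbT: h''; lia.
Qed.

Let count_factorS b l (k : 'I_(2 * n)) : l <= k ->
  count_mem b (drop l (take k.+1 D)) = count_mem b (drop l (take k D)) + ((k < g k) == b).
Proof.
move=> lk; rewrite (take_nth false) ?size_tuple // drop_rcons; last first.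
  by rewrite size_takel // size_tuple ltnW.
by rewrite -cats1 count_cat /= D_nth addn0.
Qed.

(** If [j < g i], all down-steps in [(i, j]] have partners there, yet the balanced factor followed
    by the down-step at [j] has one too many. If [g i < j], the factor cut just after [g i] already
    has more down-steps than up-steps. *)
Let matched_noncrossing (i j : 'I_(2 * n)) : matched D i j -> j = g i.
Proof.
case/and4P=> ij; rewrite !D_nth => ig jg /and3P[_ /eqP E /allP P].
apply/val_inj; case: (ltngtP j (g i)) => //= h.
  have := g_nc ij h; have := count_factorS true ij; have := count_factorS false ij.
  rewrite (negPf jg) /= -/(factor D i j) E !count_range; try by have := ltn_ord j; lia.
  have := @range_le false i.+1 j.+1; rewrite /= => H c1 c2 _.
  suff : #|range false i.+1 j.+1| <= #|range true i.+1 j.+1| by rewrite c1 c2 addn0 addn1 ltnn.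
  apply: H => k; rewrite inE => /andP[k1 /eqP/negbT k2].
  have := @g_nc i k; lia.
have := P (g i - i); rewrite mem_iota /factor size_drop size_takel ?size_tuple; last exact: ltnW.
rewrite (_ : g i - i = (g i).+1 - i.+1) // take_drop subnK; last lia.
rewrite take_takel // !(count_factorS _ ig) gK !count_range; try by have := ltn_ord j; lia.
by have := range_true_factor ig; have -> : (g i < i) = false by [lia]; rewrite /=; lia.
Qed.

Lemma tunneling_noncrossing : tunneling D =1 g.
Proof.
move=> i; rewrite permE; case/orP: (tunnel_matched i noncrossing_Dyck).
  exact: matched_noncrossing.
by move/matched_noncrossing => {2}->; rewrite gK.
Qed.

End Noncrossing.

(** * Two noncrossing matchings that differ on four points *)

Section Quadrilateral.

Variables (N p q r t : nat).
Hypotheses (pq : p < q) (qr : q < r) (rt : r < t) (tN : t < N).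
Hypotheses (oq : odd q = ~~ odd p) (or : odd r = odd p) (ot : odd t = ~~ odd p).
Hypothesis oN : ~~ odd N.

(* The vertices are joined by p-q and r-t, or by p-t and q-r, and the points
   of the four arcs between them are joined to a cyclic neighbour. *)
Definition chord (c : bool) x :=
  if x == p then if c then t else q else
  if x == q then if c then r else p else
  if x == r then if c then q else t else
  if x == t then if c then p else r else
  if ((p < x < q) || (r < x < t)) (+) (odd x == odd p)
  then (if x.+1 == N then 0 else x.+1) else (if x == 0 then N.-1 else x.-1).

Lemma chordE c x : x < N -> let y := chord c x in
  (x = p /\ y = (if c then t else q)) \/ (x = q /\ y = (if c then r else p)) \/
  (x = r /\ y = (if c then q else t)) \/ (x = t /\ y = (if c then p else r)) \/
  ((x < p \/ q < x < r \/ t < x) /\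
    (odd x = odd p /\ (x.+1 = N /\ y = 0 \/ x.+1 < N /\ y = x.+1) \/
     odd x = ~~ odd p /\ (x = 0 /\ y = N.-1 \/ 0 < x /\ y = x.-1))) \/
  ((p < x < q \/ r < x < t) /\
    (odd x = ~~ odd p /\ y = x.+1 \/ odd x = odd p /\ y = x.-1)).
Proof.
move=> xN; rewrite /= /chord.
case: eqP => [|/eqP xp]; first by move=> ->; left.
case: eqP => [|/eqP xq]; first by move=> ->; right; left.
case: eqP => [|/eqP xr]; first by move=> ->; right; right; left.
case: eqP => [|/eqP xt]; first by move=> ->; right; right; right; left.
right; right; right; right; clear oq or ot oN.
case: ((p < x < q) || (r < x < t)) / boolP => [h|h]; rewrite ?addTb ?addFb.
  right; split; first lia.
  case: eqP => [h'|/eqP h'] /=.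
    by right; rewrite ifF //; lia.
  by left; rewrite ifF; [split=> //; move: h'; do 2!case: odd | lia].
left; split; first lia.
case: eqP => [h'|/eqP h'] /=.
  by left; split=> //; case: eqP; lia.
right; split; first by move: h'; do 2!case: odd.
by case: eqP; lia.
Qed.

Lemma chord_near c x : x < N -> let y := chord c x in
  (x = p /\ y = (if c then t else q)) \/ (x = q /\ y = (if c then r else p)) \/
  (x = r /\ y = (if c then q else t)) \/ (x = t /\ y = (if c then p else r)) \/
  (y = x.+1 /\ y < N \/ x = y.+1 \/ x = 0 /\ y = N.-1 \/ x = N.-1 /\ y = 0).
Proof.
move=> xN /=; have := chordE c xN; clear oq or ot oN => /=.
move: (chord c x) => y.
case=> [|[|[|[|]]]] h; [tauto | tauto | tauto | tauto |].
by do 4!right; case: h => [[_ [[_ h]|[_ h]]]|[h' [[_ h]|[_ h]]]]; lia.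
Qed.

Lemma chord_lt c x : x < N -> chord c x < N.
Proof.
move=> xN; have := chord_near c xN; clear oq or ot oN => /=.
by move: (chord c x) => y; case: c; lia.
Qed.

Lemma chord_fix c x : x < N -> chord c x != x.
Proof.
move=> xN; have := chord_near c xN; clear oq or ot oN => /=.
by move: (chord c x) => y; case: c; lia.
Qed.

Lemma chordK c x : x < N -> chord c (chord c x) = x.
Proof.
move=> xN; have := chordE c (chord_lt c xN); have := chordE c xN.
move: (chord c _) => y; move: (chord c y) => z /=.
(* Each number is written as its parity bit plus twice a fresh variable, which leaves purely linear
   goals once the bits are known. *)
have := odd_double_half q; have := odd_double_half r; have := odd_double_half t.
have := odd_double_half N; have := odd_double_half p; rewrite oq or ot (negPf oN).
have := odd_double_half x; have := odd_double_half y; clear oq or ot oN.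
rewrite -!muln2; move: p./2 q./2 r./2 t./2 N./2 x./2 y./2 => p2 q2 r2 t2 N2 x2 y2.
move: (odd x) (odd p) (odd y) => [] [] [] /= ey ex ep eN et er eq.
all: case: c => /=.
all: case=> [[h1 h2]|[[h1 h2]|[[h1 h2]|[[h1 h2]|
  [[h1 [[// _ [h2|h2]]|[// _ [h2|h2]]]]|[[h1|h1] [[// _ h2]|[// _ h2]]]]]]]].
all: case=> [[h3 h4]|[[h3 h4]|[[h3 h4]|[[h3 h4]|
  [[h3 [[// _ [h4|h4]]|[// _ [h4|h4]]]]|[[h3|h3] [[// _ h4]|[// _ h4]]]]]]]].
all: lia.
Qed.

(** Cyclic neighbours cannot be separated by another pair, and the two chords on the four vertices
    do not cross for either value of [c]. *)
Lemma chord_nc c x y : x < N -> y < N -> x < y -> y < chord c x -> x < chord c y < chord c x.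
Proof.
move=> xN yN; have := chord_near c xN; have := chord_near c yN.
have yx : chord c y = x -> chord c x = y by move=> <-; exact: chordK.
have xy' : chord c y = chord c x -> y = x by move/(congr1 (chord c)); rewrite !chordK.
clear oq or ot oN; move: yx xy'; move: (chord c x) (chord c y) => x' y' /=.
move=> yx xy' + + xy yx'; case: c => /=.
all: case=> [[y1 y2]|[[y1 y2]|[[y1 y2]|[[y1 y2]|[y1|[y1|[y1|y1]]]]]]].
all: case=> [[x1 x2]|[[x1 x2]|[[x1 x2]|[[x1 x2]|[x1|[x1|[x1|x1]]]]]]].
all: lia.
Qed.

End Quadrilateral.

Lemma quadrilateral_Dyck n (p q r t : 'I_(2 * n)) :
    p < q -> q < r -> r < t ->
    odd q = ~~ odd p -> odd r = odd p -> odd t = ~~ odd p ->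
  exists D : bool -> (2 * n).-tuple bool,
  [/\ forall c, D c \in Dyck n,
      (tunneling (D false) p = q) * (tunneling (D false) r = t),
      (tunneling (D true) p = t) * (tunneling (D true) q = r) &
      forall x, x \notin [:: p; q; r; t] ->
        tunneling (D false) x = tunneling (D true) x].
Proof.
move=> pq qr rt oq or ot; have tN := ltn_ord t.
have oN : ~~ odd (2 * n) by rewrite mul2n odd_double.
have lt c (x : 'I_(2 * n)) : chord (2 * n) p q r t c x < 2 * n.
  exact: chord_lt.
pose g c x := Ordinal (lt c x).
have gK c : involutive (g c) by move=> x; apply/val_inj/chordK.
have gf c x : g c x != x by rewrite -val_eqE; exact: chord_fix.
have gnc c (i j : 'I_(2 * n)) : i < j -> j < g c i -> i < g c j < g c i.
  exact: chord_nc.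
exists (fun c => [tuple i < g c i | i < 2 * n]).
have T c x := tunneling_noncrossing (gK c) (gf c) (@gnc c) x.
split; first by move=> c; exact: noncrossing_Dyck.
- by split; rewrite T; apply/val_inj; rewrite /= /chord; do ![case: eqP => //=]; lia.
- by split; rewrite T; apply/val_inj; rewrite /= /chord; do ![case: eqP => //=]; lia.
move=> x; rewrite !inE -!val_eqE !negb_or => /and4P[xp xq xr xt].
rewrite !T; apply/val_inj; rewrite /= /chord.
by rewrite (negPf xp) (negPf xq) (negPf xr) (negPf xt).
Qed.

(** * Tunnels inside a set *)

(** Each tunnel inside [A] is counted at both of its ends. *)
Definition inner N (A : {set 'I_N}) (D : N.-tuple bool) : nat :=
  #|[set x in A | tunneling D x \in A]|.

Definition set_equiv n (A B : {set 'I_(2 * n)}) : Prop :=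
  forall D, D \in Dyck n -> inner A D = inner B D.

Lemma innerE N (A : {set 'I_N}) D :
  inner A D = \sum_x (x \in A) * (tunneling D x \in A).
Proof.
rewrite /inner -sum1_card big_mkcond; apply: eq_bigr => x _.
by rewrite inE; do 2!case: (_ \in A).
Qed.

(** Inclusion-exclusion on the two ends [x] and [tunneling D x], summed over all [x]. *)
Lemma inner_setC n (A : {set 'I_(2 * n)}) D :
  inner (~: A) D + 2 * #|A| = inner A D + 2 * n.
Proof.
have cA : #|A| = \sum_x (x \in A : nat).
  by rewrite -sum1_card big_mkcond; apply: eq_bigr => x _; case: (_ \in A).
have cA' : #|A| = \sum_x (tunneling D x \in A : nat).
  by rewrite cA (reindex_inj (@perm_inj _ (tunneling D))).
have -> : inner A D + 2 * n = inner A D + \sum_(x < 2 * n) 1.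
  by rewrite sum1_card card_ord.
have -> : 2 * #|A| = #|A| + #|A| by lia.
rewrite {1}cA cA' !innerE -!big_split /=.
by apply: eq_bigr => x _; rewrite !inE; do 2!case: (_ \in A).
Qed.

(* (a i - a i') (a j - a j') = (b i - b i') (b j - b j'), without subtraction. *)
Definition same_mixed_difference T (a b : T -> nat) (i i' j j' : T) : Prop :=
  a i * a j + a i' * a j' + (b i * b j' + b i' * b j) =
  b i * b j + b i' * b j' + (a i * a j' + a i' * a j).

Section MixedDifference.

Variables (T : Type) (a b : T -> nat).
Implicit Types i j k : T.

Lemma same_mixed_differenceC i i' j j' :
  same_mixed_difference a b i i' j j' -> same_mixed_difference a b j j' i i'.
Proof. rewrite /same_mixed_difference; lia. Qed.

Lemma same_mixed_difference_swap i i' j j' :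
  same_mixed_difference a b i i' j j' -> same_mixed_difference a b i i' j' j.
Proof. rewrite /same_mixed_difference; lia. Qed.

Lemma same_mixed_difference_refl i j j' : same_mixed_difference a b i i j j'.
Proof. rewrite /same_mixed_difference; lia. Qed.

Lemma same_mixed_difference_trans i i' j k l :
  same_mixed_difference a b i i' j k -> same_mixed_difference a b i i' k l ->
  same_mixed_difference a b i i' j l.
Proof. rewrite /same_mixed_difference; lia. Qed.

End MixedDifference.

Definition indicator N (A : {set 'I_N}) (x : 'I_N) : nat := x \in A.

(** With [a] the indicator of a set, its tunnel counts for the two Dyck paths differ by the product
    of [a p - a r] and [a q - a t]. *)
Lemma quadrilateral_mixed_difference n (A B : {set 'I_(2 * n)}) (p q r t : 'I_(2 * n)) :
    set_equiv A B -> p < q -> q < r -> r < t ->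
    odd q = ~~ odd p -> odd r = odd p -> odd t = ~~ odd p ->
  same_mixed_difference (indicator A) (indicator B) p r q t.
Proof.
move=> AB pq qr rt oq or ot.
have [D [DD [D1p D1r] [D2p D2q] D12]] := quadrilateral_Dyck pq qr rt oq or ot.
have TK c := tunnelingK (D c).
have D1q : tunneling (D false) q = p by rewrite -D1p TK.
have D1t : tunneling (D false) t = r by rewrite -D1r TK.
have D2t : tunneling (D true) t = p by rewrite -D2p TK.
have D2r : tunneling (D true) r = q by rewrite -D2q TK.
have ne (x y : 'I_(2 * n)) : x < y -> y != x.
  by move=> xy; rewrite -val_eqE /= neq_ltn xy orbT.
have pr := ltn_trans pq qr; have qt := ltn_trans qr rt; have pt := ltn_trans pq qt.
have split_sum (F : 'I_(2 * n) -> nat) :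
    \sum_x F x = F p + F q + F r + F t + \sum_(x | x \notin [:: p; q; r; t]) F x.
  rewrite (bigD1 p) // (bigD1 q) /=; last by rewrite ne.
  rewrite (bigD1 r) /=; last by rewrite !ne.
  rewrite (bigD1 t) /=; last by rewrite !ne.
  rewrite !addnA; congr (_ + _); apply: eq_bigl => x.
  by rewrite !inE !negb_or -!andbA.
(* Here [m] is the common contribution of the points other than the four vertices. *)
have key (X : {set 'I_(2 * n)}) : let a := indicator X in exists2 m,
    inner X (D false) = 2 * (a p * a q + a r * a t) + m
  & inner X (D true) = 2 * (a p * a t + a r * a q) + m.
  exists (\sum_(x | x \notin [:: p; q; r; t]) (x \in X) * (tunneling (D true) x \in X)).
    rewrite innerE split_sum D1p D1r D1q D1t; congr (_ + _).
      by rewrite /indicator; do 4!case: (_ \in X).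
    by apply: eq_bigr => x xN; rewrite D12.
  rewrite innerE split_sum D2p D2q D2t D2r; congr (_ + _).
  by rewrite /indicator; do 4!case: (_ \in X).
have [m1 A1 A2] := key A; have [m2 B1 B2] := key B.
have := AB _ (DD false); have := AB _ (DD true); rewrite A1 A2 B1 B2.
rewrite /same_mixed_difference; move: (indicator A) (indicator B) => a b.
clear; lia.
Qed.

(** If exactly one of [j], [j'] lies between [i] and [i'], the four points alternate in position.
    Any other pair is joined by a chain of such pairs, through [i.+1] inside and a point [o]
    outside. *)
Lemma set_equiv_mixed_difference n (A B : {set 'I_(2 * n)}) (i i' j j' : 'I_(2 * n)) :
    set_equiv A B -> odd i = odd i' -> odd j = ~~ odd i -> odd j' = ~~ odd i ->
  same_mixed_difference (indicator A) (indicator B) i i' j j'.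
Proof.
move=> AB; wlog ii : i i' / i < i'.
  move=> W oi oj oj'; case: (ltngtP i i') => h; first exact: W.
    apply/same_mixed_differenceC/same_mixed_difference_swap/same_mixed_differenceC.
    by apply: W => //; rewrite -oi.
  by rewrite (val_inj h); apply: same_mixed_difference_refl.
move=> oi oj oj'; set R := same_mixed_difference _ _ i i'.
have in_out (k l : 'I_(2 * n)) : odd k = ~~ odd i -> odd l = ~~ odd i ->
    i < k < i' -> (l < i) || (i' < l) -> R k l.
  move=> ok ol /andP[ik ki'] /orP[li|il].
    apply/same_mixed_difference_swap/same_mixed_differenceC.
    by apply: quadrilateral_mixed_difference => //; rewrite ?ok ol -?oi ?negbK.
  by apply: quadrilateral_mixed_difference; rewrite // -oi.
have iN := ltn_ord i'.
have e1 : i.+1 < 2 * n by apply: leq_ltn_trans iN.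
(* The point after [i'] serves, unless [i'] is the last one; then [i] is odd and 0 serves. *)
have [o oo o_out] : exists2 o : 'I_(2 * n), odd o = ~~ odd i & (o < i) || (i' < o).
  case: (ltnP i'.+1 (2 * n)) => h.
    by exists (Ordinal h); rewrite /= ?oi // ltnSn orbT.
  have h0 : 0 < 2 * n by apply: leq_ltn_trans iN.
  have o1 : odd i.
    rewrite oi -[odd i']negbK -oddS (_ : i'.+1 = 2 * n) ?mul2n ?odd_double //.
    by apply/eqP; rewrite eqn_leq iN.
  by exists (Ordinal h0); rewrite /= ?o1 //; case: (nat_of_ord i) o1.
have ie : i < (Ordinal e1) < i'.
  rewrite /= ltnSn /= ltn_neqAle ii andbT.
  by apply: contra_eqN oi => /eqP <- /=; case: odd.
have notin (k : 'I_(2 * n)) : odd k = ~~ odd i -> ~~ (i < k < i') -> (k < i) || (i' < k).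
  move=> ok; have ki : k != i :> nat by apply: contra_eqN ok => /eqP ->; case: odd.
  have ki' : k != i' :> nat by apply: contra_eqN ok => /eqP ->; rewrite -oi; case: odd.
  by clear -ki ki'; lia.
have eo := in_out _ _ (erefl : odd (Ordinal e1) = _) oo ie o_out.
have to_o (k : 'I_(2 * n)) : odd k = ~~ odd i -> R k o.
  move=> ok; case: (boolP (i < k < i')) => h; first exact: in_out.
  apply: same_mixed_difference_trans eo.
  by apply: same_mixed_difference_swap; apply: in_out => //; apply: notin.
apply: same_mixed_difference_trans (to_o _ oj) _.
exact/same_mixed_difference_swap/to_o.
Qed.

(** * Sets of one or both parities *)

Definition parity_class N (c : bool) : {set 'I_N} := [set x : 'I_N | odd x == c].

Definition monochromatic N (A : {set 'I_N}) : bool :=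
  [exists c, A \subset parity_class N c].

Definition bichromatic N (A : {set 'I_N}) : bool :=
  ~~ monochromatic A && ~~ monochromatic (~: A).

Lemma monochromaticS N (A B : {set 'I_N}) :
  A \subset B -> monochromatic B -> monochromatic A.
Proof.
by move=> AB /existsP[c Bc]; apply/existsP; exists c; apply: subset_trans Bc.
Qed.

Lemma monochromaticPn N (A : {set 'I_N}) :
  ~~ monochromatic A -> forall c, exists2 x, x \in A & odd x = c.
Proof.
move=> /existsPn h c; have /subsetPn[x xA] := h (~~ c).
by rewrite inE => xc; exists x => //; move: xc; case: odd; case: c.
Qed.

Lemma bichromaticC N (A : {set 'I_N}) : bichromatic (~: A) = bichromatic A.
Proof. by rewrite /bichromatic setCK andbC. Qed.

Lemma set_equivC n (A B : {set 'I_(2 * n)}) : set_equiv A B -> set_equiv B A.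
Proof. by move=> AB D DD; rewrite AB. Qed.

(** For [x], [y] of opposite parities in [A] and [x'], [y'] likewise outside, the mixed difference
    of [A] is 1, so both differences for [B] are 1 or both are -1. Replacing [x] or [y] by any [z]
    of its parity then reads off whether [z] is in [B]. *)
Lemma set_equiv_bichromatic_eq n (A B : {set 'I_(2 * n)}) :
  set_equiv A B -> bichromatic A -> B = A \/ B = ~: A.
Proof.
move=> AB /andP[/monochromaticPn inA /monochromaticPn outA].
have [x xA ox] := inA true; have [y yA oy] := inA false.
have [x' x'A ox'] := outA true; have [y' y'A oy'] := outA false.
have M := set_equiv_mixed_difference AB.
rewrite !inE in x'A y'A.
have := M x x' y y'; rewrite /same_mixed_difference /indicator ox ox' oy oy'.
rewrite xA yA (negPf x'A) (negPf y'A) => /(_ erefl erefl erefl) key.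
have [[bx bx' by_ by']|[bx bx' by_ by']] :
    [/\ x \in B, x' \notin B, y \in B & y' \notin B] \/
    [/\ x \notin B, x' \in B, y \notin B & y' \in B].
- by move: key; do 4!case: (_ \in B) => //=; [left|right].
- left; apply/setP => z; case oz: (odd z).
    have := M z x' y y'; rewrite /same_mixed_difference /indicator oz ox' oy oy'.
    rewrite yA (negPf x'A) (negPf y'A) (negPf bx') by_ (negPf by').
    by move=> /(_ erefl erefl erefl); case: (z \in A); case: (z \in B).
  have := M x x' z y'; rewrite /same_mixed_difference /indicator oz ox ox' oy'.
  rewrite xA (negPf x'A) (negPf y'A) (negPf bx') bx (negPf by').
  by move=> /(_ erefl erefl erefl); case: (z \in A); case: (z \in B).
- right; apply/setP => z; rewrite inE; case oz: (odd z).
    have := M z x' y y'; rewrite /same_mixed_difference /indicator oz ox' oy oy'.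
    rewrite yA (negPf x'A) (negPf y'A) bx' (negPf by_) by'.
    by move=> /(_ erefl erefl erefl); case: (z \in A); case: (z \in B).
  have := M x x' z y'; rewrite /same_mixed_difference /indicator oz ox ox' oy'.
  rewrite xA (negPf x'A) (negPf y'A) bx' (negPf bx) by'.
  by move=> /(_ erefl erefl erefl); case: (z \in A); case: (z \in B).
Qed.

Lemma set_equiv_bichromatic n (A B : {set 'I_(2 * n)}) :
  set_equiv A B -> bichromatic A = bichromatic B.
Proof.
have imp (X Y : {set 'I_(2 * n)}) : set_equiv X Y -> bichromatic X -> bichromatic Y.
  by move=> XY bX; have [->|->] := set_equiv_bichromatic_eq XY bX; rewrite ?bichromaticC.
by move=> AB; apply/idP/idP; apply: imp => //; apply: set_equivC.
Qed.

Lemma card_monochromatic n (A : {set 'I_(2 * n)}) : monochromatic A -> #|A| <= n.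
Proof.
case/existsP => c /subsetP Ac.
have lt (x : 'I_(2 * n)) : x./2 < n by have := ltn_ord x; lia.
have inj : {in A &, injective (fun x => Ordinal (lt x))}.
  move=> x y /Ac; rewrite inE => /eqP ox /Ac; rewrite inE => /eqP oy [h].
  by apply/val_inj; rewrite /= -[LHS]odd_double_half -[RHS]odd_double_half ox oy h.
by rewrite -(card_in_imset inj) -[leqRHS]card_ord max_card.
Qed.

Lemma monochromatic_card n (A : {set 'I_(2 * n)}) :
  monochromatic A -> #|A| = n -> exists c, A = parity_class (2 * n) c.
Proof.
case/existsP => c Ac cA; exists c; apply/eqP; rewrite eqEcard Ac cA.
by apply: card_monochromatic; apply/existsP; exists c.
Qed.

Lemma parity_classC N c : ~: parity_class N c = parity_class N (~~ c).
Proof. by apply/setP => x; rewrite !inE; case: odd; case: c. Qed.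

(** Tunnels join positions of opposite parity. *)
Lemma inner_monochromatic n (A : {set 'I_(2 * n)}) D :
  D \in Dyck n -> monochromatic A -> inner A D = 0.
Proof.
move=> DD /existsP[c /subsetP Ac]; apply/eqP; rewrite cards_eq0.
apply/eqP/setP => x; rewrite !inE; apply/negP => /andP[/Ac + /Ac].
by rewrite !inE tunneling_odd // => /eqP ->; case: (c).
Qed.

(** Truncated subtraction unites the two cases: a monochromatic [A] has at most [n] elements and no
    tunnel, and a monochromatic complement reduces to this by [inner_setC]. *)
Lemma not_bichromatic_inner n (A : {set 'I_(2 * n)}) D :
  D \in Dyck n -> ~~ bichromatic A -> inner A D = 2 * #|A| - 2 * n.
Proof.
move=> DD; rewrite negb_and !negbK => /orP[mA|mA].
  by rewrite inner_monochromatic //; have := card_monochromatic mA; lia.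
by have := inner_setC A D; rewrite (inner_monochromatic DD mA); lia.
Qed.

Lemma not_bichromatic_equiv n (A B : {set 'I_(2 * n)}) :
  ~~ bichromatic A -> ~~ bichromatic B -> #|A| = #|B| -> set_equiv A B.
Proof. by move=> nA nB cAB D DD; rewrite !not_bichromatic_inner // cAB. Qed.

Lemma setC_equiv n (A : {set 'I_(2 * n)}) : #|A| = n -> set_equiv (~: A) A.
Proof. by move=> cA D DD; have := inner_setC A D; lia. Qed.

(** * Prefix sets of a permutation *)

Section Prefixes.

Variable N : nat.
Implicit Types (s l : 'S_N) (i x : 'I_N) (k : nat).

(* [pre s k] has [k] elements, whereas [prefix_set s i] has [i.+1]. *)
Definition pre s k : {set 'I_N} := [set x | (s^-1)%g x < k].

Lemma mem_pre s k i : (s i \in pre s k) = (i < k).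
Proof. by rewrite inE permK. Qed.

Lemma pre_sub s k m : k <= m -> pre s k \subset pre s m.
Proof. by move=> km; apply/subsetP => x; rewrite !inE => /leq_trans; apply. Qed.

Lemma preS s i : pre s i.+1 = s i |: pre s i.
Proof.
apply/setP => x; rewrite -[x](permKV s) in_setU1 !mem_pre (inj_eq perm_inj).
by rewrite ltnS leq_eqVlt.
Qed.

Lemma card_pre s k : k <= N -> #|pre s k| = k.
Proof.
elim: k => [|k IH] kN; first by apply: eq_card0 => x; rewrite !inE.
by rewrite (preS s (Ordinal kN)) cardsU1 mem_pre /= ltnn IH // ltnW.
Qed.

Lemma prefix_setE s i : prefix_set s i = pre s i.+1.
Proof.
apply/setP => x; rewrite -[x](permKV s) mem_pre /prefix_set mem_imset ?inE //.
exact: perm_inj.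
Qed.

(** Products act from left to right, so [rev_perm * s] is the word of [s] read backwards. *)
Definition rev_perm : 'S_N := perm (@rev_ord_inj N).

Lemma pre_rev s k : k <= N -> pre (rev_perm * s)%g k = ~: pre s (N - k).
Proof.
move=> kN; apply/setP => x; rewrite -[x](permKV s); move: ((s^-1)%g x) => i.
have -> : s i = (rev_perm * s)%g (rev_ord i) by rewrite permM permE rev_ordK.
rewrite mem_pre permM permE rev_ordK in_setC mem_pre /=.
by have := ltn_ord i; lia.
Qed.

Lemma rev_permK s : (rev_perm * (rev_perm * s))%g = s.
Proof. by apply/permP => i; rewrite !permM !permE rev_ordK. Qed.

(** For [p + q <= N], these are the rearrangements of the first [p] and of the last [q] entries of
    [s], with the entries between them kept in place. *)
Definition block_class s p q : {set 'S_N} :=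
  [set l | [forall k : 'I_N.+1, (p <= k <= N - q) ==> (pre l k == pre s k)]].

Lemma block_classP s p q l : reflect
  (forall k, p <= k <= N - q -> pre l k = pre s k) (l \in block_class s p q).
Proof.
rewrite inE; apply: (iffP forallP) => [h k hk|h k]; last first.
  by apply/implyP => /h ->.
have kN : k < N.+1 by lia.
by have /implyP/(_ hk)/eqP := h (Ordinal kN).
Qed.

Lemma block_class1P p q l : reflect
  (forall k i, p <= k <= N - q -> (l i < k) = (i < k)) (l \in block_class 1 p q).
Proof.
apply: (iffP (block_classP _ _ _ _)) => h k.
  by move=> i hk; have /setP/(_ (l i)) := h k hk; rewrite mem_pre inE invg1 perm1.
by move=> hk; apply/setP => x; rewrite -[x](permKV l) mem_pre inE invg1 perm1 h.
Qed.

(** Dividing [l] by its restriction [u] to the first [p] points leaves a permutation of the last [q]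
    points. *)
Lemma block_class1E p q : p + q <= N ->
  block_class 1 p q = (Sym (pre 1 p) * Sym (~: pre 1 (N - q)))%g.
Proof.
move=> pqN; apply/setP => l; apply/block_class1P/imset2P => [h|[u v]].
  have nl : l \in ('N(pre 1 p | 'P))%g.
    apply/astabsP => x; rewrite /= apermE !inE invg1 !perm1; apply: h; lia.
  set u := restr_perm (pre 1 p) l.
  have uon : perm_on (pre 1 p) u by apply: restr_perm_on.
  exists u (u^-1 * l)%g; rewrite ?mulKVg ?inE //.
  apply/subsetP => x; rewrite !inE invg1 perm1 permM; apply: contra_neqN.
  move=> xq; case: (boolP (x \in pre 1 p)) => xp.
    have yp : (u^-1)%g x \in pre 1 p by rewrite -(perm_closed _ uon) permKV.
    by rewrite -(restr_permE nl yp) -/u permKV.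
  have ux : u x = x by apply: out_perm uon xp.
  rewrite -{1}ux permK; rewrite inE invg1 perm1 in xp.
  (* A middle point is fixed because [l] respects both thresholds [x] and [x.+1]. *)
  apply/val_inj/eqP; rewrite eqn_leq /=; apply/andP; split.
    by rewrite -ltnS h //; lia.
  by rewrite leqNgt h //; [rewrite ltnn | lia].
rewrite !inE => uon von -> k i hk; rewrite permM.
have vE (x : 'I_N) : (v x < k) = (x < k).
  case: (boolP (x \in ~: pre 1 (N - q))) => xq; last by rewrite (out_perm von).
  have := xq; rewrite -(perm_closed _ von); move: xq; rewrite !inE invg1 !perm1.
  by lia.
rewrite vE; case: (boolP (i \in pre 1 p)) => ip; last by rewrite (out_perm uon).
have := ip; rewrite -(perm_closed _ uon); move: ip; rewrite !inE invg1 !perm1.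
by lia.
Qed.

(** Right multiplication by [s] carries the class of the identity to that of [s], and the two
    symmetric groups meet trivially since their supports are disjoint. *)
Lemma card_block_class s p q : p + q <= N -> #|block_class s p q| = p`! * q`!.
Proof.
move=> pqN; have -> : block_class s p q = (block_class 1 p q :* s)%g.
  apply/setP => l; rewrite mem_rcoset; apply/block_classP/block_class1P => h k.
    move=> i hk; have /setP/(_ (l i)) := h k hk.
    by rewrite mem_pre inE permM.
  move=> hk; apply/setP => x; rewrite -[x](permKV l) mem_pre.
  by rewrite -(h k _ hk) permM inE.
rewrite card_rcoset block_class1E // TI_cardMg; last first.
  apply/trivgP/subsetP => u; rewrite !inE => /andP[uon von]; apply/eqP/permP => x.
  rewrite perm1; case: (boolP (x \in pre 1 p)) => xp; last exact: out_perm uon xp.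
  by apply: out_perm von _; rewrite !inE invg1 perm1 in xp *; lia.
rewrite !card_Sym [#|~: _|]cardsCs setCK !card_pre ?card_ord; try lia.
by rewrite subKn //; lia.
Qed.

End Prefixes.

(** * Equivalence in terms of prefix sets *)

Lemma inner_preS n (s : 'S_(2 * n)) D (i : 'I_(2 * n)) : D \in Dyck n ->
  inner (pre s i.+1) D = inner (pre s i) D + 2 * (tunneling D (s i) \in pre s i).
Proof.
move=> DD; rewrite !innerE preS; set x := s i; set g := tunneling D.
have gx : g x != x by apply: tunneling_fixfree.
rewrite (bigD1 x) // (bigD1 (g x)) //= [in RHS](bigD1 x) // [in RHS](bigD1 (g x)) //=.
rewrite /g tunnelingK -/g !in_setU1 eqxx (negPf gx) /= !mem_pre ltnn mul1n muln1 muln0.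
set S1 := \sum_(_ | _) _; set S2 := \sum_(_ | _) _.
suff -> : S1 = S2 by move: (S2) => S; case: (g x \in pre s i); rewrite /= ?mul0n; clear; lia.
apply: eq_bigr => y /andP[yx ygx]; rewrite !in_setU1 (negPf yx).
suff /negPf-> : g y != x by [].
by apply: contra_neq ygx => <-; rewrite /g tunnelingK.
Qed.

Lemma sigma_pathE n (s : 'S_(2 * n)) D (i : 'I_(2 * n)) : D \in Dyck n ->
  tnth (sigma_path s D) i = (tunneling D (s i) \notin pre s i).
Proof.
move=> DD; rewrite tnth_mktuple prefix_setE preS in_setU1.
by rewrite (negPf (tunneling_fixfree _ DD)).
Qed.

(** By [inner_preS], each letter records whether [inner] grows at that position. *)
Lemma path_equivP n (l s : 'S_(2 * n)) : reflect
  (forall k, k <= 2 * n -> set_equiv (pre l k) (pre s k)) (path_equiv l s).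
Proof.
apply: (iffP forall_inP) => [h k kN D DD|h D DD].
  elim: k kN => [|k IH] kN.
    by rewrite /inner !eq_card0 // => x; rewrite !inE.
  rewrite !(@inner_preS _ _ _ (Ordinal kN)) // IH ?(ltnW kN) //; congr (_ + 2 * _).
  have /eqP/(congr1 (fun t => ~~ tnth t (Ordinal kN))) := h D DD.
  by rewrite !sigma_pathE // !negbK => ->.
apply/eqP/eq_from_tnth => i; rewrite !sigma_pathE //; congr (~~ _).
have := h _ (ltn_ord i) _ DD; rewrite !inner_preS // (h _ (ltnW (ltn_ord i)) _ DD).
by move/addnI; do 2!case: (_ \in _).
Qed.

Lemma monochromatic_card_le1 N (A : {set 'I_N}) : #|A| <= 1 -> monochromatic A.
Proof.
move/card_le1_eqP => h; case: (set_0Vmem A) => [->|[x xA]]; apply/existsP.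
  by exists true; apply: sub0set.
by exists (odd x); apply/subsetP => y yA; rewrite inE (h x y).
Qed.

(** Two such subsets of [Z] share an element because [1 < k], so they have the same colour. Their
    union is then monochromatic, hence not [Z], and has only [k] elements. *)
Lemma monochromatic_unique N (X Y Z : {set 'I_N}) k :
    X \subset Z -> Y \subset Z -> 1 < k -> #|X| = k -> #|Y| = k -> #|Z| = k.+1 ->
    monochromatic X -> monochromatic Y -> ~~ monochromatic Z ->
  X = Y.
Proof.
move=> XZ YZ k1 cX cY cZ /existsP[c Xc] /existsP[d Yd] mZ.
have UZ : X :|: Y \subset Z by rewrite subUset XZ.
have := subset_leq_card UZ; have := cardsUI X Y; rewrite cX cY cZ => cUI cU.
have /card_gt0P[x] : 0 < #|X :&: Y| by lia.
rewrite inE => /andP[xX xY].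
have cd : c = d.
  have := subsetP Xc _ xX; have := subsetP Yd _ xY.
  by rewrite !inE => /eqP <- /eqP <-.
have mU : monochromatic (X :|: Y) by apply/existsP; exists c; rewrite subUset Xc cd.
have U_le : #|X :|: Y| <= k.
  rewrite leqNgt; apply: contra mZ => kU.
  suff -> : Z = X :|: Y by [].
  by apply/esym/eqP; rewrite eqEcard UZ cZ.
have -> : X = X :|: Y by apply/eqP; rewrite eqEcard subsetUl cX.
by apply/esym/eqP; rewrite eqEcard subsetUr cY.
Qed.

Lemma not_bichromatic_small n (A : {set 'I_(2 * n)}) :
  #|A| < n -> ~~ bichromatic A -> monochromatic A.
Proof.
move=> cA; rewrite negb_and !negbK => /orP[//|/card_monochromatic].
by rewrite cardsCs setCK card_ord; lia.
Qed.

Lemma not_bichromatic_half n (A : {set 'I_(2 * n)}) :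
  #|A| = n -> ~~ bichromatic A -> exists c, A = parity_class (2 * n) c.
Proof.
move=> cA; rewrite negb_and !negbK => /orP[mA|mA]; first exact: monochromatic_card.
have [|c /(congr1 (fun X => ~: X))] := monochromatic_card mA.
  by rewrite cardsCs setCK card_ord cA; lia.
by rewrite setCK parity_classC => ->; exists (~~ c).
Qed.

(** * Equivalence classes *)

Lemma monochromatic_pre N (s : 'S_N) a :
    0 < a < N -> entry s a != entry s a.+1 %[mod 2] ->
    (forall k, 0 < k < N -> entry s k != entry s k.+1 %[mod 2] -> a <= k) ->
  forall k, monochromatic (pre s k) = (k <= a).
Proof.
move=> aN ea amin k.
(* Entries are counted from 1, ordinals from 0, so the parities are opposite. *)
have eE (i : 'I_N) : entry s i.+1 %% 2 = ~~ odd (s i) by rewrite entryE modn2 oddS.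
have N0 : 0 < N by lia.
have a1 : a.-1 < N by lia.
have a2 : a < N by lia.
apply/idP/idP => [/existsP[c /subsetP h]|ka].
  rewrite leqNgt; apply: contra ea => ak.
  have := h (s (Ordinal a1)); have := h (s (Ordinal a2)).
  rewrite !mem_pre !inE /= => /(_ ak)/eqP o2 /(_ ltac:(lia))/eqP o1.
  have -> : a = (Ordinal a1).+1 by rewrite /=; lia.
  by rewrite eE o1 -[(Ordinal a1).+1]/(a.-1.+1) prednK ?(eE (Ordinal a2)) ?o2 //; lia.
apply/existsP; exists (odd (s (Ordinal N0))); apply/subsetP => x.
rewrite -[x](permKV s) mem_pre; move: ((s^-1)%g x) => [i iN] /= ik.
rewrite inE; elim: i iN ik => [|i IH] iN ik; first by rewrite (bool_irrelevance N0 iN).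
have iN' := ltnW iN; rewrite -(eqP (IH iN' (ltnW ik))).
have : ~~ (entry s i.+1 != entry s i.+2 %[mod 2]).
  by apply/negP => /(amin i.+1 ltac:(lia)); lia.
rewrite negbK (eE (Ordinal iN')) (eE (Ordinal iN)).
by case: (odd (s (Ordinal iN))); case: (odd (s (Ordinal iN'))).
Qed.

Lemma entry_rev N (s : 'S_N) k : 0 < k <= N ->
  entry (rev_perm N * s)%g k = entry s (N + 1 - k).
Proof.
case: k => // k /andP[_ kN]; rewrite (entryE _ (Ordinal kN)) permM permE.
by rewrite -entryE /=; congr entry; lia.
Qed.

(** * Classes from the lengths of the monochromatic head and tail *)

Section ClassOfPrefixes.

Variables (n : nat) (s : 'S_(2 * n)) (a b : nat).
Hypothesis hn : 2 < n.
Hypothesis mono_head : forall k, k <= 2 * n -> monochromatic (pre s k) = (k <= a).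
Hypothesis mono_tail : forall k, k <= 2 * n ->
  monochromatic (~: pre s k) = (2 * n - k <= b).

Let card_preC (l : 'S_(2 * n)) k : k <= 2 * n -> #|~: pre l k| = 2 * n - k.
Proof. by move=> kN; rewrite cardsCs setCK card_ord card_pre. Qed.

Let bichromatic_pre k : k <= 2 * n -> bichromatic (pre s k) = (a < k) && (b < 2 * n - k).
Proof. by move=> kN; rewrite /bichromatic mono_head // mono_tail // -!ltnNge. Qed.

Lemma head_length_le : a <= n.
Proof.
rewrite leqNgt; apply/negP => an; have := mono_head (k := n.+1) ltac:(lia).
by rewrite an => /card_monochromatic; rewrite card_pre; lia.
Qed.

Lemma tail_length_le : b <= n.
Proof.
rewrite leqNgt; apply/negP => bn; have := mono_tail (k := n.-1) ltac:(lia).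
have -> : 2 * n - n.-1 <= b by lia.
by move/card_monochromatic; rewrite card_preC; lia.
Qed.

(** A monochromatic set of size [n] is a full parity class, and its complement is the other one. *)
Lemma head_full_tail_full : (a == n) = (b == n).
Proof.
have := mono_head (k := n) ltac:(lia); have := mono_tail (k := n) ltac:(lia).
have := head_length_le; have := tail_length_le; have -> : 2 * n - n = n by lia.
have mC (A : {set 'I_(2 * n)}) : #|A| = n -> monochromatic A -> monochromatic (~: A).
  move=> cA /monochromatic_card/(_ cA)[c ->]; rewrite parity_classC.
  by apply/existsP; exists (~~ c).
move=> bn an mt mh; apply/eqP/eqP => h.
  have : monochromatic (~: pre s n) by apply: mC; rewrite ?card_pre ?mh ?h //; lia.
  by rewrite mt; lia.
have : monochromatic (pre s n).
  by rewrite -[pre s n]setCK; apply: mC; rewrite ?card_preC ?mt ?h //; lia.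
by rewrite mh; lia.
Qed.

(** Sets of size at most 1 are monochromatic, which permits a block of size 2 even if [a] or [b] is
    1. A larger prefix of size below [p] forces [p <= a], and it lies in a monochromatic prefix of
    [s]; dually at the tail. *)
Lemma block_class_not_bichromatic p q l k :
    p <= maxn a 2 -> q <= maxn b 2 -> p + q <= 2 * n -> l \in block_class s p q ->
    k <= 2 * n -> ~~ (p <= k <= 2 * n - q) ->
  ~~ bichromatic (pre l k).
Proof.
move=> pa qb pq /block_classP bl kN kpq; rewrite negb_and !negbK.
case: (ltnP k p) => kp.
  apply/orP; left; case: (leqP k 1) => k1.
    by apply: monochromatic_card_le1; rewrite card_pre.
  apply: (monochromaticS (B := pre l p)); first by apply: pre_sub; lia.
  by rewrite bl ?mono_head; lia.
apply/orP; right; case: (leqP (2 * n - k) 1) => k1.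
  by apply: monochromatic_card_le1; rewrite card_preC.
apply: (monochromaticS (B := ~: pre l (2 * n - q))).
  by rewrite setCS; apply: pre_sub; lia.
by rewrite bl ?mono_tail; lia.
Qed.

Lemma block_class_path_equiv p q l :
    p <= maxn a 2 -> q <= maxn b 2 -> p + q <= 2 * n -> l \in block_class s p q ->
  path_equiv l s.
Proof.
move=> pa qb pq bl; apply/path_equivP => k kN.
case: (boolP (p <= k <= 2 * n - q)) => kpq.
  by move/block_classP: bl => ->.
apply: not_bichromatic_equiv; last by rewrite !card_pre.
  exact: block_class_not_bichromatic bl kN kpq.
by apply: (block_class_not_bichromatic pa qb pq) kN kpq; apply/block_classP.
Qed.

Lemma pre_head_unique l : 1 < a -> a < n -> ~~ bichromatic (pre l a) ->
  pre l a.+1 = pre s a.+1 -> pre l a = pre s a.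
Proof.
move=> a1 an nb E; have aN : a.+1 <= 2 * n by lia.
apply: (monochromatic_unique (Z := pre s a.+1) (k := a)) => //.
- by rewrite -E; apply: pre_sub.
- exact: pre_sub.
- by rewrite card_pre // ltnW.
- by rewrite card_pre // ltnW.
- by rewrite card_pre.
- by apply: not_bichromatic_small; rewrite // card_pre ?(ltnW aN).
- by rewrite mono_head ?leqnn ?(ltnW aN).
- by rewrite mono_head // ltnn.
Qed.

Lemma pre_tail_unique l k : k + b = 2 * n -> 1 < b -> b < n -> ~~ bichromatic (pre l k) ->
  pre l k.-1 = pre s k.-1 -> pre l k = pre s k.
Proof.
move=> kb b1 bn nb E; apply: setC_inj.
apply: (monochromatic_unique (Z := ~: pre s k.-1) (k := b)) => //.
- by rewrite -E setCS; apply: pre_sub; lia.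
- by rewrite setCS; apply: pre_sub; lia.
- by rewrite card_preC; lia.
- by rewrite card_preC; lia.
- by rewrite card_preC; lia.
- by apply: not_bichromatic_small; rewrite ?bichromaticC // card_preC; lia.
- by rewrite mono_tail; lia.
- by rewrite mono_tail; lia.
Qed.

(** If the half-size prefixes are not bichromatic, both are parity classes, so the same alternative
    holds. *)
Lemma path_equiv_half l : path_equiv l s -> pre l n = pre s n \/ pre l n = ~: pre s n.
Proof.
move=> /path_equivP/(_ n ltac:(lia))/set_equivC E.
case: (boolP (bichromatic (pre s n))) => [|nb]; first exact: set_equiv_bichromatic_eq.
have nb' : ~~ bichromatic (pre l n) by rewrite -(set_equiv_bichromatic E).
have [|c ->] := not_bichromatic_half _ nb; first by rewrite card_pre; lia.
have [|d ->] := not_bichromatic_half _ nb'; first by rewrite card_pre; lia.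
by rewrite parity_classC; case: c; case: d; [left|right|right|left].
Qed.

(** * Balanced case: [a] and [b] both equal to [n] or both to [n - 1] *)

Section Balanced.

Variable m : nat.
Hypotheses (am : a = m) (bm : b = m) (mn : n.-1 <= m <= n).

Let block := block_class s m m.

Let s_not_bichromatic k : k <= 2 * n -> k != n -> ~~ bichromatic (pre s k).
Proof. by move=> kN kn; rewrite bichromatic_pre //; lia. Qed.

Let block_not_bichromatic l k : l \in block -> k <= 2 * n -> k != n ->
  ~~ bichromatic (pre l k).
Proof.
move=> bl kN kn; case: (boolP (m <= k <= 2 * n - m)) => kpq.
  by move/block_classP: bl => ->; rewrite // s_not_bichromatic.
by apply: block_class_not_bichromatic bl kN kpq; rewrite ?am ?bm; lia.
Qed.

Let pre_rev_half (l : 'S_(2 * n)) : pre (rev_perm _ * l)%g n = ~: pre l n.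
Proof. by rewrite pre_rev; [congr (~: pre _ _)|]; lia. Qed.

(** Reversal complements the prefix of size [n], which no tunnel count detects; the other prefixes
    are not bichromatic. *)
Let rev_block_path_equiv l : l \in block -> path_equiv (rev_perm _ * l)%g s.
Proof.
move=> bl; apply/path_equivP => k kN; case: (eqVneq k n) => [->|kn].
  rewrite pre_rev_half; move/block_classP: bl => ->; last by lia.
  by apply: setC_equiv; rewrite card_pre; lia.
apply: not_bichromatic_equiv; last by rewrite !card_pre.
  by rewrite pre_rev // bichromaticC; apply: block_not_bichromatic => //; lia.
exact: s_not_bichromatic.
Qed.

Let half_block l : (forall k, k <= 2 * n -> k != n -> ~~ bichromatic (pre l k)) ->
  (* Sizes other than [n] arise only for [m = n - 1], and are then [a] and [2 * n - b], next to
     [n]. *)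
  pre l n = pre s n -> l \in block.
Proof.
move=> nb E; apply/block_classP => k kpq; case: (ltngtP k n) => [kn|kn|-> //].
  have ka : k = a by lia.
  rewrite ka; apply: pre_head_unique; [lia|lia|apply: nb; lia|].
  by have -> : a.+1 = n by lia.
apply: pre_tail_unique; [lia|lia|lia|apply: nb; lia|].
by have -> : k.-1 = n by lia.
Qed.

Lemma path_class_balanced :
  path_class s = block :|: [set (rev_perm (2 * n) * l)%g | l in block].
Proof.
apply/setP => l; rewrite !inE; apply/idP/idP => [ls|/orP[bl|/imsetP[l' bl ->]]].
- have nb k : k <= 2 * n -> k != n -> ~~ bichromatic (pre l k).
    move=> kN kn; move/path_equivP/(_ k kN)/set_equiv_bichromatic: ls => ->.
    exact: s_not_bichromatic.
  have [E|E] := path_equiv_half ls; apply/orP; [left|right].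
    by have := half_block nb E; rewrite inE.
  apply/imsetP; exists (rev_perm _ * l)%g; last by rewrite rev_permK.
  apply: half_block; last by rewrite pre_rev_half E setCK.
  by move=> k kN kn; rewrite pre_rev // bichromaticC; apply: nb; lia.
- by apply: (@block_class_path_equiv m m); rewrite ?inE ?am ?bm //; lia.
exact: rev_block_path_equiv.
Qed.

Lemma card_path_class_balanced : #|path_class s| = 2 * m`! * m`!.
Proof.
rewrite path_class_balanced cardsU (_ : _ :&: _ = set0); last first.
  (* A common element would make the nonempty set [pre s n] its own complement. *)
  apply/setP => l; rewrite in_set0 in_setI; apply/negP.
  case/andP=> /block_classP bl /imsetP[l' /block_classP bl' E].
  have := bl n ltac:(lia); rewrite E pre_rev_half bl'; last by lia.
  have /card_gt0P[x xs] : 0 < #|pre s n| by rewrite card_pre; lia.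
  by move=> /setP/(_ x); rewrite in_setC xs.
rewrite card_imset; last exact: mulgI.
by rewrite cards0 subn0 /block card_block_class; lia.
Qed.

End Balanced.

(** * Unbalanced case *)

Hypotheses (an : a < n) (bn : b < n) (ab : ~~ ((a == n - 1) && (b == n - 1))).

Let path_equiv_pre l k : path_equiv l s -> a < k < 2 * n - b -> pre l k = pre s k.
Proof.
move=> /path_equivP ls akb.
have alt j : a < j < 2 * n - b -> pre l j = pre s j \/ pre l j = ~: pre s j /\ j = n.
  move=> hj; have jN : j <= 2 * n by lia.
  have [|->|E] := set_equiv_bichromatic_eq (set_equivC (ls j jN)).
  - by rewrite bichromatic_pre; lia.
  - by left.
  right; split=> //; have := congr1 (fun X : {set _} => #|X|) E.
  by rewrite /= card_preC // card_pre //; lia.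
case: (alt k akb) => [//|[E kn]]; rewrite {}kn in E akb *.
have /card_gt0P[x xs] : 0 < #|pre s n.-1| by rewrite card_pre; lia.
(* Size [n - 1] is in the range if [a < n - 1]; otherwise [b < n - 1] and size [n + 1] is. In the
   second case [pre s n.+1] would contain [pre s n] and its complement. *)
case: (ltnP a n.-1) => an1.
  have [|E'|[_]] := alt n.-1; [lia| |lia].
  have := subsetP (pre_sub l (leq_pred n)) x; rewrite E' => /(_ xs).
  by rewrite E in_setC (subsetP (pre_sub s (leq_pred n)) x xs).
have [|E'|[_]] := alt n.+1; [lia| |lia].
suff : setT \subset pre s n.+1.
  by move/subset_leq_card; rewrite cardsT card_ord card_pre; lia.
apply/subsetP => y _; case: (boolP (y \in pre s n)) => ys.
  exact: subsetP (pre_sub s (leqnSn n)) y ys.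
by rewrite -E'; apply: (subsetP (pre_sub l (leqnSn n))); rewrite E in_setC.
Qed.

Lemma path_class_unbalanced : path_class s = block_class s (maxn a 2) (maxn b 2).
Proof.
apply/setP => l; rewrite inE; apply/idP/idP => [ls|]; last first.
  by apply: block_class_path_equiv; lia.
have nb k : k <= 2 * n -> ~~ ((a < k) && (b < 2 * n - k)) -> ~~ bichromatic (pre l k).
  by move=> kN; move/path_equivP/(_ k kN)/set_equiv_bichromatic: ls => ->; rewrite bichromatic_pre.
apply/block_classP => k kab.
case: (boolP (a < k < 2 * n - b)) => h; first exact: path_equiv_pre.
(* Only [k = a] and [k = 2 * n - b] remain, each next to a size already settled. *)
case: (leqP k a) => ka.
  have -> : k = a by lia.
  by apply: pre_head_unique; [lia|lia|apply: nb; lia|apply: path_equiv_pre; lia].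
by apply: pre_tail_unique; [lia|lia|lia|apply: nb; lia|apply: path_equiv_pre; lia].
Qed.

Lemma card_path_class_unbalanced : #|path_class s| = (maxn a 2)`! * (maxn b 2)`!.
Proof. by rewrite path_class_unbalanced card_block_class; lia. Qed.

End ClassOfPrefixes.

Theorem theorem4 (n : nat) (s : 'S_(2 * n)) (a b : nat)
    (hn : 3 <= n) (hpar : par s = (a, b)) :
  #|path_class s| =
    if (a == n) && (b == n) then 2 * n`! * n`!
    else if (a == n - 1) && (b == n - 1) then 2 * (n - 1)`! * (n - 1)`!
    else (maxn a 2)`! * (maxn b 2)`!.
Proof.
have [|[aN ea amin] [bN eb bmin]] := parP s; first by lia.
rewrite hpar /= in aN ea amin bN eb bmin.
have mh k (_ : k <= 2 * n) : monochromatic (pre s k) = (k <= a).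
  exact: monochromatic_pre.
have mt k : k <= 2 * n -> monochromatic (~: pre s k) = (2 * n - k <= b).
  (* The complement of a prefix is a prefix of the reversed word, whose head has length [b]. *)
  move=> kN; rewrite -[in LHS](subKn kN) -pre_rev; last lia.
  have eS j : 0 < j < 2 * n -> entry (rev_perm (2 * n) * s)%g j.+1 = entry s (2 * n - j).
    by move=> hj; rewrite entry_rev; [congr entry; lia | lia].
  apply: monochromatic_pre => //; first by rewrite eS // entry_rev //; lia.
  by move=> j hj; rewrite eS // entry_rev; [apply: bmin|lia].
have an := head_length_le hn mh; have bn := tail_length_le hn mt.
have abn := head_full_tail_full hn mh mt.
case: ifP => [/andP[/eqP ha /eqP hb]|nab].
  by apply: card_path_class_balanced ha hb _ => //; lia.
case: ifP => [/andP[/eqP ha /eqP hb]|/negbT nab'].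
  by apply: card_path_class_balanced ha hb _ => //; lia.
(* By [abn], neither of [a] and [b] equals [n] alone, so both are smaller. *)
by apply: card_path_class_unbalanced => //; move: nab abn; do 2!case: eqP => //=; lia.
Qed.
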